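(* Let $n_t,n_r,n_e\ge 1$, $P_t>0$, $H\in\mathbb{C}^{n_r\times n_t}$ and $G\in\mathbb{C}^{n_e\times n_t}$, and assume that $G^HG-H^HH$ is not positive semidefinite. Let $Q^*$ be an optimal input covariance matrix under the average power constraint, i.e. a maximizer of $$R(Q)=\log|HQH^H+I|-\log|GQG^H+I|$$ over all Hermitian positive semidefinite $Q\in\mathbb{C}^{n_t\times n_t}$ with $\mathrm{Tr}(Q)\le P_t$. Then $$\mathrm{rank}(Q^* )\le m,$$ where $m$ is the number of positive eigenvalues (counted with multiplicity) of the Hermitian matrix $H^HH-G^HG$.
   Context: $|\cdot|$ denotes the determinant and $(\cdot)^H$ the conjugate transpose. $I$ denotes an identity matrix of the appropriate size. $R(Q)$ is the secrecy rate of the MIMO Gaussian wiretap channel $y_r=Hx+z_r$, $y_e=Gx+z_e$ with input covariance $Q$; its maximum over $Q\succeq 0$, $\mathrm{Tr}(Q)\le P_t$ is the secrecy capacity $\mathcal{C}_{sec}(P_t)$. *)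

(* Defs.v *)
From HB Require Import structures.
From mathcomp Require Import all_boot all_order all_algebra.
From mathcomp Require Import complex.
From mathcomp Require Import reals exp.

Set Implicit Arguments.
Unset Strict Implicit.
Unset Printing Implicit Defensive.

Import Order.TTheory GRing.Theory Num.Theory.
Local Open Scope ring_scope.
Local Open Scope sesquilinear_scope.
Local Open Scope complex_scope.

(* In a numClosedFieldType, [0 <= z] means that z is real and nonnegative, and
   [0 < z] that z is real and positive. *)
Definition psdmx (C : numClosedFieldType) (n : nat) (A : 'M[C]_n) : Prop :=
  A \is hermsymmx /\ forall x : 'cV[C]_n, 0 <= (x ^t* *m A *m x) 0 0.

Definition eigenvals (C : numClosedFieldType) (n : nat) (A : 'M[C]_n) : seq C :=
  sval (closed_field_poly_normal (char_poly A)).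

(* The list has n elements: multiplicities are counted. *)
Lemma eigenvalsE (C : numClosedFieldType) (n : nat) (A : 'M[C]_n) :
  char_poly A = \prod_(a <- eigenvals A) ('X - a%:P).
Proof.
rewrite /eigenvals; case: closed_field_poly_normal => s /= {1}->.
by rewrite (monicP (char_poly_monic A)) scale1r.
Qed.

Definition num_pos_eigenvals (C : numClosedFieldType) (n : nat) (A : 'M[C]_n) :
  nat := count (fun a => 0 < a) (eigenvals A).

(* For Q positive semidefinite both determinants are real and at least 1, so
   taking real parts only changes the type from R[i] to R. *)
Definition secrecy_rate (R : realType) (nt nr ne : nat)
    (H : 'M[R[i]]_(nr, nt)) (G : 'M[R[i]]_(ne, nt)) (Q : 'M[R[i]]_nt) : R :=
  ln (complex.Re (\det (H *m Q *m H ^t* + 1%:M))) -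
  ln (complex.Re (\det (G *m Q *m G ^t* + 1%:M))).

Definition feasible_cov (R : realType) (nt : nat) (Pt : R)
    (Q : 'M[R[i]]_nt) : Prop :=
  psdmx Q /\ \tr Q <= Pt%:C.

Definition optimal_cov (R : realType) (nt nr ne : nat) (Pt : R)
    (H : 'M[R[i]]_(nr, nt)) (G : 'M[R[i]]_(ne, nt)) (Q : 'M[R[i]]_nt) : Prop :=
  feasible_cov Pt Q /\
  forall Q' : 'M[R[i]]_nt, feasible_cov Pt Q' ->
    secrecy_rate H G Q' <= secrecy_rate H G Q.

(* Main.v *)
(* Write [A = H^H H], [B = G^H G].  A rank-one change [Q + e v v^H] multiplies
   [det (H Q H^H + I)] by [1 + e gain H Q v], with
   [gain H Q v = (H v)^H (H Q H^H + I)^-1 (H v)].  If [z^H A z > z^H B z], the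
   choice [v = z + Q A z] gives [gain H Q v > gain G Q v], so an optimal [Q]
   leaves no power unused.  If the rank of [Q] exceeds the number of positive
   eigenvalues of [A - B], some nonzero [z] in the range of [Q] satisfies
   [z^H A z <= z^H B z]; then [v = z + Q B z] has [gain H Q v <= gain G Q v], and
   subtracting a small multiple of [v v^H] saves power without lowering the
   rate: an optimum with unused power, a contradiction. *)
Require Import Defs.
From HB Require Import structures.
From mathcomp Require Import all_boot all_order all_algebra.
From mathcomp Require Import complex.
From mathcomp Require Import reals exp.
From mathcomp Require Import ring.

Set Implicit Arguments.
Unset Strict Implicit.
Unset Printing Implicit Defensive.

Import Order.TTheory GRing.Theory Num.Theory.
Local Open Scope ring_scope.
Local Open Scope sesquilinear_scope.
Local Open Scope complex_scope.

(** * Conjugate transposes, squared norms and positive semidefinite matrices *)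

Lemma adjmxM (C : numClosedFieldType) m n p (A : 'M[C]_(m, n)) (B : 'M_(n, p)) :
  (A *m B)^t* = B^t* *m A^t*.
Proof. by rewrite trmx_mul map_mxM. Qed.

Lemma adjmxD (C : numClosedFieldType) m n (A B : 'M[C]_(m, n)) :
  (A + B)^t* = A^t* + B^t*.
Proof. by rewrite linearD map_mxD. Qed.

Lemma adjmxB (C : numClosedFieldType) m n (A B : 'M[C]_(m, n)) :
  (A - B)^t* = A^t* - B^t*.
Proof. by rewrite linearB map_mxB. Qed.

Lemma adjmxZ (C : numClosedFieldType) m n (a : C) (A : 'M[C]_(m, n)) :
  (a *: A)^t* = a^* *: A^t*.
Proof. by rewrite linearZ map_mxZ. Qed.

Lemma adjmx1 (C : numClosedFieldType) n : (1%:M : 'M[C]_n)^t* = 1%:M.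
Proof. by rewrite trmx1 map_mx1. Qed.

Lemma hermsymmxP (C : numClosedFieldType) n (A : 'M[C]_n) :
  reflect (A^t* = A) (A \is hermsymmx).
Proof.
apply: (iffP (is_hermitianmxP _ _ _)); rewrite expr0 scale1r.
  by move=> <-.
by move=> ->.
Qed.

Lemma col_sqnormE (C : numClosedFieldType) n (x : 'cV[C]_n) :
  (x^t* *m x) 0 0 = \sum_i `|x i 0| ^+ 2.
Proof. by rewrite mxE; apply: eq_bigr => i _; rewrite !mxE normCKC. Qed.

Lemma col_sqnorm_ge0 (C : numClosedFieldType) n (x : 'cV[C]_n) :
  0 <= (x^t* *m x) 0 0.
Proof. by rewrite col_sqnormE sumr_ge0 // => i _; rewrite exprn_ge0. Qed.

Lemma col_sqnorm_eq0 (C : numClosedFieldType) n (x : 'cV[C]_n) :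
  ((x^t* *m x) 0 0 == 0) = (x == 0).
Proof.
apply/idP/eqP => [|->]; last by rewrite mulmx0 mxE eqxx.
rewrite col_sqnormE psumr_eq0 => [/allP x0|i _]; last by rewrite exprn_ge0.
apply/colP => i; rewrite mxE; apply/eqP.
by have := x0 i (mem_index_enum i); rewrite expf_eq0 normr_eq0.
Qed.

Lemma col_sqnorm_gt0 (C : numClosedFieldType) n (x : 'cV[C]_n) :
  (0 < (x^t* *m x) 0 0) = (x != 0).
Proof. by rewrite lt0r col_sqnorm_eq0 col_sqnorm_ge0 andbT. Qed.

Lemma psdmx_congr (C : numClosedFieldType) m n (M : 'M[C]_(m, n)) (Q : 'M_n) :
  psdmx Q -> psdmx (M *m Q *m M^t*).
Proof.
move=> [/hermsymmxP Qh Qp]; split=> [|x].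
  by apply/hermsymmxP; rewrite !adjmxM trmxCK Qh mulmxA.
by have := Qp (M^t* *m x); rewrite adjmxM trmxCK !mulmxA.
Qed.

Lemma psdmxD (C : numClosedFieldType) n (A B : 'M[C]_n) :
  psdmx A -> psdmx B -> psdmx (A + B).
Proof.
move=> [/hermsymmxP Ah Ap] [/hermsymmxP Bh Bp]; split=> [|x].
  by apply/hermsymmxP; rewrite adjmxD Ah Bh.
by rewrite mulmxDr mulmxDl mxE addr_ge0.
Qed.

Lemma psdmx_rank1 (C : numClosedFieldType) n (e : C) (v : 'cV[C]_n) :
  0 <= e -> psdmx (e *: (v *m v^t*)).
Proof.
move=> e0; split=> [|x].
  by apply/hermsymmxP; rewrite adjmxZ adjmxM trmxCK geC0_conj.
rewrite -scalemxAr -scalemxAl mxE mulr_ge0 // mulmxA.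
by have := col_sqnorm_ge0 (v^t* *m x); rewrite adjmxM trmxCK mulmxA.
Qed.

(** * Spectral decomposition and positivity of determinants *)

Lemma hermitian_spectralE (C : numClosedFieldType) n (A : 'M[C]_n) :
  A \is hermsymmx ->
  A = (spectralmx A)^t* *m diag_mx (spectral_diag A) *m spectralmx A.
Proof.
move=> /hermitian_normalmx/orthomx_spectralP {1}->.
by rewrite invmx_unitary ?spectral_unitarymx.
Qed.

Lemma qform_spectral (C : numClosedFieldType) n (A : 'M[C]_n) (x : 'cV_n) :
  A \is hermsymmx ->
  (x^t* *m A *m x) 0 0 =
  \sum_i spectral_diag A 0 i * `|(spectralmx A *m x) i 0| ^+ 2.
Proof.
move=> /hermitian_spectralE AE; rewrite {1}AE !mulmxA -[_ *m spectralmx A *m x]mulmxA.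
rewrite -adjmxM mul_mx_diag mxE.
by apply: eq_bigr => i _; rewrite !mxE normCKC mulrAC [in RHS]mulrC.
Qed.

(** The determinant is the product of the eigenvalues, and the form takes the [i]-th eigenvalue as
    its value at the [i]-th unit eigenvector [invmx U *m delta_mx i 0]. *)
Lemma det_posdef_gt0 (C : numClosedFieldType) n (A : 'M[C]_n) :
  A \is hermsymmx -> (forall x : 'cV_n, x != 0 -> 0 < (x^t* *m A *m x) 0 0) ->
  0 < \det A.
Proof.
move=> Ah Ap; set U := spectralmx A.
have Uu : U \in unitmx by apply: spectral_unit.
have /hermitian_normalmx/orthomx_spectralP -> := Ah.
rewrite !det_mulmx det_inv mulrC mulrA divrr -?unitmxE // mul1r det_diag.
apply: prodr_gt0 => i _.
have /Ap : invmx U *m delta_mx i 0 != 0 :> 'cV_n.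
  apply/eqP => /(congr1 (mulmx U)) /matrixP/(_ i 0)/eqP.
  by rewrite mulKVmx // mulmx0 !mxE !eqxx oner_eq0.
rewrite qform_spectral // mulKVmx // (bigD1 i) //= big1 ?addr0 => [|j ji].
  by rewrite mxE !eqxx normr1 expr1n mulr1.
by rewrite mxE (negPf ji) normr0 expr0n mulr0.
Qed.

Lemma det1DpsdM_gt0 (C : numClosedFieldType) n (A : 'M[C]_n) :
  psdmx A -> 0 < \det (A + 1%:M).
Proof.
move=> [/hermsymmxP Ah Ap]; apply: det_posdef_gt0 => [|x x0].
  by apply/hermsymmxP; rewrite adjmxD Ah adjmx1.
by rewrite mulmxDr mulmxDl mulmx1 mxE ltr_wpDl // col_sqnorm_gt0.
Qed.

(** * Rank-one updates of determinants and the gain *)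

(** Both sides equal [\det M]: multiplying [M] on the right by a unit triangular block matrix clears
    either its upper right or its lower left block. *)
Lemma det_1DcolM (R : comNzRingType) n (x : 'cV[R]_n) (w : 'rV_n) :
  \det (1%:M + x *m w) = 1 + (w *m x) 0 0.
Proof.
set M := block_mx 1%:M (- w) x 1%:M.
have -> : \det (1%:M + x *m w) = \det M.
  have := det_mulmx M (block_mx 1%:M w 0 1%:M).
  rewrite mulmx_block !mul1mx !mulmx1 !mulmx0 !addr0 addrN.
  by rewrite det_lblock det_ublock !det1 !mulr1 mul1r addrC.
have := det_mulmx M (block_mx 1%:M 0 (- x) 1%:M).
rewrite mulmx_block !mul1mx !mulmx1 !mulmx0 !add0r addrN.
rewrite det_ublock det_lblock !det1 !mulr1 mulmxN mulNmx opprK => <-.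
by rewrite det_mx11 !mxE eqxx.
Qed.

Lemma det_rank1_update (F : fieldType) n (A : 'M[F]_n) (u : 'cV_n) (w : 'rV_n) :
  A \in unitmx -> \det (A + u *m w) = \det A * (1 + (w *m invmx A *m u) 0 0).
Proof.
move=> Au; rewrite -mulmxA -det_1DcolM -det_mulmx mulmxDr mulmx1.
by rewrite mulmxA mulKVmx.
Qed.

Definition gain (C : numClosedFieldType) m n (H : 'M[C]_(m, n)) (Q : 'M_n)
    (v : 'cV_n) : C :=
  ((H *m v)^t* *m invmx (H *m Q *m H^t* + 1%:M) *m (H *m v)) 0 0.

Lemma noise_cov_unit (C : numClosedFieldType) m n (H : 'M[C]_(m, n)) (Q : 'M_n) :
  psdmx Q -> H *m Q *m H^t* + 1%:M \in unitmx.
Proof.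
by move=> Qp; rewrite unitmxE unitfE gt_eqF // det1DpsdM_gt0 //; apply: psdmx_congr.
Qed.

Lemma noise_cov_herm (C : numClosedFieldType) m n (H : 'M[C]_(m, n)) (Q : 'M_n) :
  psdmx Q -> (H *m Q *m H^t* + 1%:M)^t* = H *m Q *m H^t* + 1%:M.
Proof.
by case=> /hermsymmxP Qh _; rewrite adjmxD adjmx1 !adjmxM trmxCK Qh mulmxA.
Qed.

Lemma det_gain (C : numClosedFieldType) m n (H : 'M[C]_(m, n)) (Q : 'M_n) e v :
  psdmx Q ->
  \det (H *m (Q + e *: (v *m v^t*)) *m H^t* + 1%:M) =
  \det (H *m Q *m H^t* + 1%:M) * (1 + e * gain H Q v).
Proof.
move=> Qp; rewrite mulmxDr mulmxDl addrAC.
have -> : H *m (e *: (v *m v^t*)) *m H^t* = (H *m v) *m (e *: (H *m v)^t*).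
  by rewrite -!scalemxAr -scalemxAl adjmxM !mulmxA.
by rewrite det_rank1_update ?noise_cov_unit // -!scalemxAl [in LHS]mxE.
Qed.

(** With [P] the matrix inverted in [gain], [H] sends this vector to [P *m (H *m z)], so one [P]
    cancels the inverse. This is the equality case of the bound [gain_le], at [b = H^H H z]. *)
Lemma gainE (C : numClosedFieldType) m n (H : 'M[C]_(m, n)) (Q : 'M_n) z :
  psdmx Q ->
  gain H Q (z + Q *m (H^t* *m H *m z)) =
  ((H *m z)^t* *m (H *m z)) 0 0 +
  ((H^t* *m H *m z)^t* *m Q *m (H^t* *m H *m z)) 0 0.
Proof.
move=> Qp; rewrite /gain; set P := (_ + 1%:M).
have -> : H *m (z + Q *m (H^t* *m H *m z)) = P *m (H *m z).
  by rewrite mulmxDl mul1mx mulmxDr addrC !mulmxA.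
rewrite adjmxM (noise_cov_herm H Qp) -/P -!mulmxA mulKmx ?noise_cov_unit //.
rewrite mulmxDl mul1mx mulmxDr mxE addrC; congr (_ + _).
by rewrite !adjmxM trmxCK !mulmxA.
Qed.

(* The right-hand side exceeds the left-hand side by [|u|^2 + s^H Q s], where
   [u = w - H z], [s = H^H w - b] and [w] is the inverse of
   [H Q H^H + I] applied to [H (z + Q b)]. *)
Lemma gain_le (C : numClosedFieldType) m n (H : 'M[C]_(m, n)) (Q : 'M_n) z b :
  psdmx Q ->
  gain H Q (z + Q *m b) <=
  ((H *m z)^t* *m (H *m z)) 0 0 + (b^t* *m Q *m b) 0 0.
Proof.
move=> Qp; have [/hermsymmxP Qh Q0] := Qp.
rewrite /gain; set P := (_ + 1%:M); set a := H *m z.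
have Pu : P \in unitmx by apply: noise_cov_unit.
have -> : H *m (z + Q *m b) = a + H *m Q *m b by rewrite mulmxDr mulmxA.
rewrite -[_ *m (a + _)]mulmxA; set w := invmx P *m (a + H *m Q *m b).
have Pw : P *m w = a + H *m Q *m b by rewrite /w mulKVmx.
clearbody w; rewrite -Pw adjmxM (noise_cov_herm H Qp) -/P.
set u := w - a; set s := H^t* *m w - b.
have us : u + H *m Q *m s = 0.
  rewrite /u /s mulmxBr addrACA -opprD -Pw mulmxDl mul1mx [P in w + P]mulmxA.
  by rewrite [w + _]addrC subrr.
have -> : a = w - u by rewrite /u opprB addrC subrK.
have -> : b = H^t* *m w - s by rewrite /s opprB addrC subrK.
(* The cross terms of the expansion [main] vanish: [cross1] is [us] multiplied by [w^H], and
   [cross2] is its conjugate transpose. *)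
have cross1 : w^t* *m u + w^t* *m H *m Q *m s = 0.
  by rewrite -!mulmxA -mulmxDr [H *m _]mulmxA us mulmx0.
have cross2 : u^t* *m w + s^t* *m Q *m H^t* *m w = 0.
  rewrite -[LHS]trmxCK adjmxD !adjmxM !trmxCK Qh !mulmxA.
  by rewrite cross1 trmx0 map_mx0.
clearbody u s; have main : (w - u)^t* *m (w - u) +
    (H^t* *m w - s)^t* *m Q *m (H^t* *m w - s) =
    w^t* *m P *m w + (u^t* *m u + s^t* *m Q *m s) -
    (w^t* *m u + w^t* *m H *m Q *m s) -
    (u^t* *m w + s^t* *m Q *m H^t* *m w).
  rewrite !adjmxB !adjmxM trmxCK /P.
  rewrite !(mulmxBl, mulmxBr, mulmxDl, mulmxDr, mulmxN) !mulmxA !mulmx1.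
  have addE (A B : 'M[C]_1) i j : (A + B) i j = A i j + B i j by rewrite mxE.
  have oppE (A : 'M[C]_1) i j : (- A) i j = - A i j by rewrite mxE.
  by apply/matrixP => i j; rewrite !(addE, oppE); ring.
rewrite cross1 cross2 !subr0 in main.
move/matrixP/(_ 0 0): main; rewrite mxE => ->.
by rewrite [leRHS]mxE lerDl mxE addr_ge0 ?col_sqnorm_ge0.
Qed.

(** * Counting positive eigenvalues against the rank *)

(** The characteristic polynomial is invariant under similarity, so its list of roots is a
    permutation of the spectral diagonal. *)
Lemma num_pos_eigenvals_herm (C : numClosedFieldType) n (A : 'M[C]_n) :
  A \is hermsymmx ->
  num_pos_eigenvals A = #|[pred i | 0 < spectral_diag A 0 i]|.
Proof.
move=> /hermitian_normalmx/orthomx_spectralP AE.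
have cpE : char_poly A = \prod_i ('X - (spectral_diag A 0 i)%:P).
  have Uu := spectral_unit A.
  transitivity (char_poly (diag_mx (spectral_diag A))).
    rewrite /char_poly /char_poly_mx {1}AE !map_mxM.
    set U := map_mx _ (spectralmx A); set V := map_mx _ (invmx _).
    have VU : V *m U = 1%:M by rewrite -map_mxM mulVmx // map_mx1.
    have XE : 'X%:M = V *m 'X%:M *m U :> 'M[{poly C}]_n.
      by rewrite scalar_mxC -mulmxA VU mulmx1.
    rewrite [in LHS]XE -mulmxBl -mulmxBr !det_mulmx mulrAC -det_mulmx VU det1 mul1r //.
  rewrite char_poly_trig ?diag_mx_is_trig //.
  by apply: eq_bigr => i _; rewrite mxE eqxx.
have: perm_eq (eigenvals A) [seq spectral_diag A 0 i | i : 'I_n].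
  by apply: prod_XsubC_eq; rewrite -eigenvalsE cpE big_map big_enum.
rewrite /num_pos_eigenvals => /permP ->.
by rewrite count_map -sum1_count big_enum_cond sum1_card.
Qed.

(** A dimension count: asking [Q *m s] to have no component along the eigenvectors with positive
    eigenvalue imposes fewer conditions than [\rank Q], so some [s] outside the kernel of [Q] meets
    them all. *)
Lemma nonpos_vector (C : numClosedFieldType) n (A Q : 'M[C]_n) :
  A \is hermsymmx -> (num_pos_eigenvals A < \rank Q)%N ->
  exists s : 'cV_n, Q *m s != 0 /\ ((Q *m s)^t* *m A *m (Q *m s)) 0 0 <= 0.
Proof.
move=> Ah; rewrite num_pos_eigenvals_herm //.
set d := spectral_diag A; set U := spectralmx A.
set J := [pred i | _] => rQ.
(* [S *m s] lists the coordinates of [Q *m s] along the eigenvectors indexed by [J]. *)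
pose S := (\matrix_(i < #|J|, j < n) (j == enum_val i)%:R) *m (U *m Q).
have SQ : (\rank S < \rank Q)%N by apply: leq_ltn_trans (rank_leq_row S) rQ.
(* [kermx] is a left kernel, hence the transposes. *)
have : ~~ (kermx S^T <= kermx Q^T)%MS.
  apply/negP => /mxrankS; rewrite !mxrank_ker !mxrank_tr leqNgt ltn_sub2l //.
  by apply: leq_trans SQ (rank_leq_row Q).
move=> /row_subPn[k]; rewrite sub_kermx => kQ.
pose s := (row k (kermx S^T))^T; exists s.
have Qs0 : Q *m s != 0 by rewrite /s -trmx_eq0 trmx_mul trmxK.
have Ss0 : S *m s = 0.
  by apply/trmx_inj; rewrite /s trmx_mul trmxK trmx0 -row_mul mulmx_ker row0.
split=> //; rewrite qform_spectral //; apply: sumr_le0 => i _.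
have [di|/negPf di] := boolP (0 < d 0 i).
  have Ji : i \in J by [].
  move/matrixP/(_ (enum_rank_in Ji i) 0): Ss0.
  rewrite -mulmxA -[U *m Q *m s]mulmxA mxE (bigD1 i) //= big1 => [|j ji].
    by rewrite !mxE enum_rankK_in // eqxx mul1r addr0 => ->; rewrite normr0 expr0n mulr0.
  by rewrite [X in X * _]mxE enum_rankK_in // (negPf ji) mul0r.
rewrite mulr_le0_ge0 ?exprn_ge0 //.
(* The order on [C] is partial; realness of the eigenvalue turns the failure of [0 < d 0 i] into
   [d 0 i <= 0]. *)
have /mxOverP/(_ 0 i) := hermitian_spectral_diag_real Ah.
by move=> dreal; rewrite real_leNgt ?real0 -?/d ?di.
Qed.

(** * The secrecy rate under rank-one changes of the covariance *)

Lemma Re_gt0 (R : realType) (x : R[i]) : 0 < x -> 0 < complex.Re x.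
Proof. by rewrite ltcE => /andP[]. Qed.

Lemma ln_ReM (R : realType) (x y : R[i]) : 0 < x -> 0 < y ->
  ln (complex.Re (x * y)) = ln (complex.Re x) + ln (complex.Re y).
Proof.
move=> x0 y0; rewrite -lnM ?posrE ?Re_gt0 //; congr ln.
by rewrite -(RRe_real (gtr0_real x0)) -(RRe_real (gtr0_real y0)) -rmorphM.
Qed.

(** By [det_gain] this factor is the ratio of two positive determinants. *)
Lemma gain_gtN1 (C : numClosedFieldType) m n (H : 'M[C]_(m, n)) (Q : 'M_n) e v :
  psdmx Q -> psdmx (Q + e *: (v *m v^t*)) -> 0 < 1 + e * gain H Q v.
Proof.
move=> Qp Q'p; have := det1DpsdM_gt0 (psdmx_congr H Q'p).
by rewrite det_gain // pmulr_rgt0 // det1DpsdM_gt0 //; apply: psdmx_congr.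
Qed.

Lemma secrecy_rate_gain (R : realType) (nt nr ne : nat) (H : 'M[R[i]]_(nr, nt))
    (G : 'M[R[i]]_(ne, nt)) (Q : 'M_nt) e v :
  psdmx Q -> psdmx (Q + e *: (v *m v^t*)) ->
  secrecy_rate H G (Q + e *: (v *m v^t*)) =
  secrecy_rate H G Q + (ln (complex.Re (1 + e * gain H Q v)) -
                        ln (complex.Re (1 + e * gain G Q v))).
Proof.
move=> Qp Q'p; rewrite /secrecy_rate !det_gain //.
by rewrite !ln_ReM ?gain_gtN1 ?det1DpsdM_gt0 //; [ring|..]; apply: psdmx_congr.
Qed.

(** For [b = H^H H z], [gain_le] bounds the gain of [G] while [gainE] computes that of [H]; the
    common term [b^H Q b] drops out of the comparison. Every step [e > 0] then raises the rate, so
    only the power limits [e]. *)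
Lemma secrecy_rate_slack (R : realType) (nt nr ne : nat) (Pt : R)
    (H : 'M[R[i]]_(nr, nt)) (G : 'M[R[i]]_(ne, nt)) (Q : 'M_nt) (z : 'cV_nt) :
  psdmx Q -> \tr Q < Pt%:C ->
  ((G *m z)^t* *m (G *m z)) 0 0 < ((H *m z)^t* *m (H *m z)) 0 0 ->
  exists2 Q', feasible_cov Pt Q' & secrecy_rate H G Q < secrecy_rate H G Q'.
Proof.
move=> Qp trQ zGH; pose v := z + Q *m (H^t* *m H *m z).
have gGH : gain G Q v < gain H Q v.
  by apply: le_lt_trans (gain_le _ _ _ Qp) _; rewrite gainE // ltrD2r.
pose k := 1 + (v^t* *m v) 0 0; have k0 : 0 < k by rewrite ltr_wpDr ?col_sqnorm_ge0.
pose e := (Pt%:C - \tr Q) / k.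
have e0 : 0 < e by rewrite divr_gt0 ?subr_gt0.
have Q'p : psdmx (Q + e *: (v *m v^t*)).
  by apply: psdmxD => //; apply: psdmx_rank1; apply: ltW.
exists (Q + e *: (v *m v^t*)).
  split=> //; rewrite mxtraceD mxtraceZ mxtrace_mulC trace_mx11 -lerBrDl.
  rewrite -[leRHS](divfK (lt0r_neq0 k0)) -/e ler_pM2l //.
  by rewrite /k lerDr.
rewrite secrecy_rate_gain // ltrDl subr_gt0 ltr_ln ?posrE ?Re_gt0 ?gain_gtN1 //.
have : 1 + e * gain G Q v < 1 + e * gain H Q v by rewrite ltrD2l ltr_pM2l.
by rewrite ltcE => /andP[].
Qed.

(** The roles of [H] and [G] are exchanged: [gainE] is applied to [G] and [gain_le] to [H]. Since
    [z = Q *m s], the direction [v] stays in the range of [Q], which lets a multiple of [v v^H] be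
    subtracted without losing semidefiniteness. *)
Lemma secrecy_rate_downdate (R : realType) (nt nr ne : nat)
    (H : 'M[R[i]]_(nr, nt)) (G : 'M[R[i]]_(ne, nt)) (Q : 'M_nt) (s : 'cV_nt) :
  psdmx Q -> Q *m s != 0 ->
  ((H *m (Q *m s))^t* *m (H *m (Q *m s))) 0 0 <=
  ((G *m (Q *m s))^t* *m (G *m (Q *m s))) 0 0 ->
  exists Q', [/\ psdmx Q', \tr Q' < \tr Q &
    secrecy_rate H G Q <= secrecy_rate H G Q'].
Proof.
move=> Qp; set z := Q *m s => z0 zHG; have [/hermsymmxP Qh Q0] := Qp.
pose b := G^t* *m G *m z; pose t := s + b; pose v := Q *m t.
have vE : v = z + Q *m b by rewrite /v mulmxDr.
have gHG : gain H Q v <= gain G Q v.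
  by rewrite vE gainE //; apply: le_trans (gain_le _ _ _ Qp) _; rewrite lerD2r.
(* If [v] were zero, its gain would vanish, forcing [G *m z = 0], then [b = 0] and
   [z = - Q b = 0]. *)
have v0 : v != 0.
  apply: contra z0 => /eqP v0; have zE : z = - (Q *m b).
    by apply/eqP; rewrite -addr_eq0 -vE v0.
  have : ((G *m z)^t* *m (G *m z)) 0 0 + (b^t* *m Q *m b) 0 0 = 0.
    by rewrite -gainE // -/b -vE v0 /gain mulmx0 mulmx0 mxE.
  move/eqP; rewrite paddr_eq0 ?col_sqnorm_ge0 // col_sqnorm_eq0 => /andP[/eqP Gz _].
  by rewrite zE /b -mulmxA Gz !mulmx0 oppr0.
pose k := (t^t* *m Q *m t) 0 0; have k0 : 0 <= k by apply: Q0.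
(* As [Q t = v] and [t^H Q t = k], the congruence of [Q] by [I - c v t^H] equals
   [Q - (2 c - c^2 k) v v^H]. This fixes [e], and the choice of [c] gives [c k < 1], so that [e] is
   positive. *)
pose c := (1 + k)^-1; have k1 : 0 < 1 + k by rewrite ltr_wpDr.
have c0 : 0 < c by rewrite invr_gt0.
pose e := c * (2 - c * k).
have e0 : 0 < e.
  rewrite mulr_gt0 // subr_gt0 (@lt_trans _ _ 1) ?ltr1n //.
  by rewrite mulrC ltr_pdivrMr // mul1r ltrDr.
have vt : v^t* = t^t* *m Q by rewrite adjmxM Qh.
have Qt : Q *m t = v by [].
clearbody v.
(* The choice of [e] makes the downdate a congruence, hence psd. *)
have Q'E : Q + (- e) *: (v *m v^t*) =
    (1%:M - c *: (v *m t^t*)) *m Q *m (1%:M - c *: (v *m t^t*))^t*.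
  rewrite adjmxB adjmx1 adjmxZ (geC0_conj (ltW c0)) adjmxM trmxCK.
  rewrite !(mulmxBl, mulmxBr) !mul1mx !mulmx1 -!scalemxAl -!scalemxAr.
  rewrite !mulmxA -[v *m t^t* *m Q]mulmxA -vt.
  rewrite Qt -[v *m v^t* *m t]mulmxA.
  have -> : v^t* *m t = k%:M by rewrite vt /k -mx11_scalar.
  rewrite mul_mx_scalar -scalemxAl !scalerA /e.
  by apply/matrixP => i j; rewrite !mxE; ring.
have Q'p : psdmx (Q + (- e) *: (v *m v^t*)) by rewrite Q'E; apply: psdmx_congr.
exists (Q + (- e) *: (v *m v^t*)); split=> //.
  rewrite mxtraceD mxtraceZ mxtrace_mulC trace_mx11 gtrDl mulNr oppr_lt0.
  by rewrite mulr_gt0 // col_sqnorm_gt0.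
rewrite secrecy_rate_gain // lerDl subr_ge0 ler_ln ?posrE ?Re_gt0 ?gain_gtN1 //.
have : 1 + - e * gain G Q v <= 1 + - e * gain H Q v.
  by rewrite lerD2l !mulNr lerN2 ler_pM2l.
by rewrite lecE => /andP[].
Qed.

(** * Differences of Gram matrices and the rank bound *)

Lemma qform_gramB (C : numClosedFieldType) n m p (A : 'M[C]_(m, n))
    (B : 'M[C]_(p, n)) (x : 'cV_n) :
  (x^t* *m (A^t* *m A - B^t* *m B) *m x) 0 0 =
  ((A *m x)^t* *m (A *m x)) 0 0 - ((B *m x)^t* *m (B *m x)) 0 0.
Proof.
have oppE (M : 'M[C]_1) : (- M) 0 0 = - M 0 0 by rewrite mxE.
by rewrite mulmxBr mulmxBl !adjmxM !mulmxA [LHS]mxE oppE.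
Qed.

Lemma gramB_herm (C : numClosedFieldType) n m p (A : 'M[C]_(m, n))
    (B : 'M[C]_(p, n)) : A^t* *m A - B^t* *m B \is hermsymmx.
Proof. by apply/hermsymmxP; rewrite adjmxB !adjmxM !trmxCK. Qed.

Theorem theorem1 (R : realType) (nt nr ne : nat) (Pt : R)
    (H : 'M[R[i]]_(nr, nt)) (G : 'M[R[i]]_(ne, nt)) (Qstar : 'M[R[i]]_nt)
    (hnt : (1 <= nt)%N) (hnr : (1 <= nr)%N) (hne : (1 <= ne)%N)
    (hPt : 0 < Pt)
    (hGH : ~ psdmx (G ^t* *m G - H ^t* *m H))
    (hQ : optimal_cov Pt H G Qstar) :
  (\rank Qstar <= num_pos_eigenvals (H ^t* *m H - G ^t* *m G))%N.
Proof.
have [[Qp trQ] Qmax] := hQ; rewrite leqNgt; apply/negP => rankQ.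
have [s [Qs0]] := nonpos_vector (gramB_herm H G) rankQ.
rewrite qform_gramB subr_le0 => zHG.
have [Q' [Q'p trQ' RQ']] := secrecy_rate_downdate Qp Qs0 zHG.
(* If some [x] had [|G x| < |H x|], the power saved by [Q'] could be spent to exceed the optimal
   rate. So there is none, and [G^H G - H^H H] is positive semidefinite, against [hGH]. *)
apply: hGH; split=> [|x]; first exact: gramB_herm.
rewrite qform_gramB subr_ge0 real_leNgt ?ger0_real ?col_sqnorm_ge0 //.
apply/negP => xGH.
have [Q'' feas] := secrecy_rate_slack Q'p (lt_le_trans trQ' trQ) xGH.
by apply/negP; rewrite -leNgt; apply: le_trans (Qmax _ feas) RQ'.
Qed.
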